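(* For all integers $k \ge 2$, $m(k) \le (4/3)\lfloor \log_2 k \rfloor + 2$.
   Context: A topology on a finite set $X$ is a collection of subsets of $X$ containing $\emptyset$ and $X$ and closed under unions and finite intersections; its members are open sets. For an integer $k \ge 2$, $m(k)$ is the smallest positive integer $n$ such that there exists a topology on an $n$-point set having exactly $k$ open sets. *)

(* Defs.v *)
From mathcomp Require Import all_boot.

Set Implicit Arguments.
Unset Strict Implicit.
Unset Printing Implicit Defensive.

Definition is_topology (X : finType) (O : {set {set X}}) : bool :=
  [&& set0 \in O, [set: X] \in O,
      [forall P : {set {set X}}, (P \subset O) ==> (cover P \in O)] &
      [forall A in O, forall B in O, A :&: B \in O]].

Definition has_topology_of_card (k n : nat) : bool :=
  (0 < n) && [exists O : {set {set 'I_n}}, is_topology O && (#|O| == k)].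

(* Witness: the initial segments of a chain with [k.-1] points. *)
Lemma ex_topology_of_card (k : nat) :
  2 <= k -> exists n, has_topology_of_card k n.
Proof.
case: k => [|[|k]] // _; exists k.+1; rewrite /has_topology_of_card /=.
pose U (i : 'I_k.+2) : {set 'I_k.+1} := [set x : 'I_k.+1 | x < i].
have Uinj : injective U.
  have H (i j : 'I_k.+2) : i < j -> U i <> U j.
    move=> lt_ij /setP eqU.
    have ik : i < k.+1 by apply: leq_trans lt_ij _; rewrite -ltnS.
    by have := eqU (Ordinal ik); rewrite !inE /= ltnn lt_ij.
  move=> i j eqU; apply: val_inj => /=.
  by case: (ltngtP i j) => // /H; [case | move/(_ (esym eqU))].
apply/existsP; exists [set U i | i in 'I_k.+2].
rewrite card_imset // card_ord eqxx andbT.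
have U0 : set0 \in [set U i | i in 'I_k.+2].
  by apply/imsetP; exists ord0 => //; apply/setP => x; rewrite !inE.
apply/and4P; split=> //.
- apply/imsetP; exists ord_max => //.
  by apply/setP => x; rewrite !inE /= ltn_ord.
- apply/forallP => P; apply/implyP => /subsetP sP; rewrite /cover.
  apply: (big_ind (fun A => A \in [set U i | i in 'I_k.+2])) => //.
  move=> _ _ /imsetP[i _ ->] /imsetP[j _ ->]; apply/imsetP.
  case: (leqP i j) => ij; [exists j | exists i] => //;
    apply/setP => x; rewrite !inE.
  + by case: ltnP => //= xi; rewrite (leq_trans xi ij).
  + by case: (ltnP x j) => xj; rewrite ?orbF // (ltn_trans xj ij).
apply/forall_inP => _ /imsetP[i _ ->].
apply/forall_inP => _ /imsetP[j _ ->]; apply/imsetP.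
case: (leqP i j) => ij; [exists i | exists j] => //;
  apply/setP => x; rewrite !inE.
- by case: ltnP => //= xi; rewrite (leq_trans xi ij).
- by case: (ltnP x j) => xj; rewrite ?andbF // (ltn_trans xj ij).
Qed.

Definition m (k : nat) (hk : 2 <= k) : nat := ex_minn (ex_topology_of_card hk).
Arguments m k hk : clear implicits.

(* Main.v *)
(* Call an open set with exactly three open sets above it a tracker. Adding a
   point whose smallest neighbourhood is [x |: U] turns the number [a K] of open
   sets above an old open set [K] into [a K + a (K :|: U)]. Start from [q] open
   sets and a tracker, add [3t] isolated points and then up to [t] points [x_j],
   each above some of the isolated points and above either the tracker or the
   whole old space. This yields [8 ^ t * q + r] open sets, where the [x_j]
   determine [r], and a new tracker. For [t <= 3] such gadgets realize enough
   residues [r] that every [k] has one of them as its residue modulo [8 ^ t], so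
   three binary digits cost four points. The case [k < 3 * 8 ^ t] is finite and
   uses a few more gadgets and twenty explicit spaces. The gadgets and spaces
   were found by computer search. *)
Require Import Defs.
From mathcomp Require Import all_boot all_order all_algebra.
From mathcomp Require Import lra zify.

Set Implicit Arguments.
Unset Strict Implicit.
Unset Printing Implicit Defensive.

(** * Topologies on finite types, and the number of open sets above a given set *)

Section Topology.
Variables (X : finType) (O : {set {set X}}).

(** On a finite set every union is built from [set0] by binary unions, so closure under these
    suffices. *)
Lemma is_topologyP :
  reflect [/\ set0 \in O, [set: X] \in O,
              {in O &, forall A B, A :|: B \in O} &
              {in O &, forall A B, A :&: B \in O}]
          (is_topology O).
Proof.
apply: (iffP and4P) => [[O0 OT /forallP OU /forall_inP OI]|[O0 OT OU OI]].
  split=> // A B OA OB; last by exact: (forall_inP (OI A OA)).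
  suff -> : A :|: B = cover [set A; B].
    by apply: implyP (OU _) _; apply/subsetP => C /set2P[] ->.
  apply/setP => x; rewrite /cover inE; apply/orP/bigcupP => [[] xA|[C]].
  - by exists A; rewrite ?set21.
  - by exists B; rewrite ?set22.
  - by move=> /set2P[] ->; [left | right].
split=> //; last by do 2!apply/forall_inP => ? ?; apply: OI.
apply/forallP => P; apply/implyP => /subsetP sPO; rewrite /cover.
by apply: (big_ind (fun A => A \in O)) => //= A B; apply: OU.
Qed.

Definition above (K : {set X}) : nat := #|[set V in O | K \subset V]|.

Lemma above0 : above set0 = #|O|.
Proof. by apply: eq_card => V; rewrite inE sub0set andbT. Qed.

Lemma aboveT : is_topology O -> above setT = 1.
Proof.
case/is_topologyP => _ OT _ _; rewrite -(cards1 [set: X]).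
apply: eq_card => V; rewrite !inE subTset andbC.
by case: eqP => // ->.
Qed.

End Topology.

(** * Adjoining one point with a prescribed smallest neighbourhood *)

Section AddPoint.
Variables (X : finType) (O : {set {set X}}) (U : {set X}).
Hypotheses (topO : is_topology O) (OU : U \in O).

(* [None] is a new point whose smallest open neighbourhood is [None |: U]. *)
Definition add_point : {set {set option X}} :=
  [set A : {set option X} | (Some @^-1: A \in O)
     && ((None \in A) ==> (U \subset Some @^-1: A))].

Let preimSome (K : {set X}) : Some @^-1: (Some @: K) = K.
Proof. by apply/setP => x; rewrite inE mem_imset //; apply: Some_inj. Qed.

Let preimNone (K : {set X}) : Some @^-1: (None |: Some @: K) = K.
Proof. by apply/setP => x; rewrite !inE mem_imset //; apply: Some_inj. Qed.

Let NoneSome (K : {set X}) : None \in Some @: K = false.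
Proof. by apply/imsetP => -[]. Qed.

Lemma add_point_topology : is_topology add_point.
Proof.
case/is_topologyP: topO => O0 OT OUn OI; apply/is_topologyP.
rewrite !inE preimsetT preimset0 O0 OT subsetT implybT; split=> // A B.
  rewrite !inE preimsetU => /andP[OA /implyP UA] /andP[OB /implyP UB].
  rewrite OUn //=; apply/implyP => /orP[/UA|/UB] /subset_trans; apply.
    exact: subsetUl.
  exact: subsetUr.
rewrite !inE preimsetI => /andP[OA /implyP UA] /andP[OB /implyP UB].
by rewrite OI //=; apply/implyP => /andP[/UA UA' /UB UB']; rewrite subsetI UA'.
Qed.

Lemma add_point_old (K : {set X}) : K \in O -> Some @: K \in add_point.
Proof. by move=> OK; rewrite inE preimSome OK NoneSome. Qed.

Lemma add_point_new (K : {set X}) :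
  K \in O -> None |: Some @: (K :|: U) \in add_point.
Proof.
move=> OK; rewrite inE preimNone subsetUr implybT andbT.
by case/is_topologyP: topO => _ _ OUn _; apply: OUn.
Qed.

(** An open set containing [None] is determined by its trace on the old points, which may be any
    open set containing [U]. *)
Lemma above_new (K : {set X}) :
  above add_point (None |: Some @: (K :|: U)) = above O (K :|: U).
Proof.
have inj : injective (fun V : {set X} => None |: Some @: V).
  by move=> V V' e; rewrite -[V]preimNone e preimNone.
rewrite /above -(card_imset _ inj); apply: eq_card => A; rewrite !inE.
rewrite subUset sub1set sub_imset_pre; apply/idP/imsetP.
  case/andP=> /andP[OA _] /andP[NA KA]; exists (Some @^-1: A).
    by rewrite inE OA.
  apply/setP => -[x|]; rewrite !inE ?NA // mem_imset ?inE //.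
  exact: Some_inj.
case=> V; rewrite inE => /andP[OV KV] ->.
by rewrite preimNone OV KV !inE eqxx (subset_trans _ KV) // subsetUr.
Qed.

(** The open sets above [Some @: K] are split by membership of [None]. Without it the trace is any
    open set above [K]; with it the trace must also contain [U], which gives the second summand. *)
Lemma above_old (K : {set X}) :
  above add_point (Some @: K) = above O K + above O (K :|: U).
Proof.
have inj : injective (fun V : {set X} => Some @: V).
  by move=> V V' e; rewrite -[V]preimSome e preimSome.
rewrite -above_new /above -(card_imset _ inj).
rewrite -(cardsID [set A : {set option X} | None \in A]) addnC.
congr (_ + _); apply: eq_card => A; rewrite !inE.
  rewrite sub_imset_pre; apply/idP/imsetP.
    case/andP=> NA /andP[/andP[OA _] KA]; exists (Some @^-1: A).
      by rewrite inE OA.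
    apply/setP => -[x|]; rewrite ?NoneSome ?(negPf NA) //.
    by rewrite mem_imset ?inE //; apply: Some_inj.
  case=> V; rewrite inE => /andP[OV KV] ->.
  by rewrite preimSome OV KV NoneSome.
rewrite subUset sub1set !sub_imset_pre subUset.
case NA: (None \in A); rewrite ?andbF //= !andbT.
by case: (_ \in O); case: (U \subset _); rewrite ?andbF ?andbT.
Qed.

End AddPoint.

(** * Symbolic counting of open sets after a sequence of added points *)

(* A pair [(e, s)] denotes the open set generated by level [e] of the initial
   space (empty set, tracker, whole space) and the points added at the stages
   listed in [s], numbered from 0; as a new point, it gives what lies below. *)
Definition opn : Type := nat * seq nat.

Definition join (l c : opn) : opn := (maxn l.1 c.1, l.2 ++ c.2).

(* [count w g l] is [(a, b)] when [a * q + b] open sets contain [l], where [q]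
   and [w] are the numbers of open sets of the initial space and of those above
   the tracker; the head of [g] is the last point added. *)
Fixpoint count (w : nat) (g : seq opn) (l : opn) : nat * nat :=
  if g is c :: g' then
    if size g' \in l.2 then count w g' (join l c)
    else if c is (0, [::]) then
      let v := count w g' l in (v.1 + v.1, v.2 + v.2)
    else
      let v := count w g' l in let v' := count w g' (join l c) in
      (v.1 + v'.1, v.2 + v'.2)
  else match l.1 with 0 => (1, 0) | 1 => (0, w) | _ => (0, 1) end.

(** The branch for isolated points is only a shortcut: joining with [(0, [::])] changes nothing, so
    one recursive call serves for both summands and computation stays cheap. *)
Lemma count_cons w c g l :
  count w (c :: g) l =
    if size g \in l.2 then count w g (join l c)
    else ((count w g l).1 + (count w g (join l c)).1,
          (count w g l).2 + (count w g (join l c)).2).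
Proof.
rewrite /=; case: ifP => // _; case: c => [[|e] [|i s]] //.
by rewrite /join /= maxn0 cats0 -surjective_pairing.
Qed.

(** Induction on [g], each step being [above_new] or [above_old]. That [phi] turns [join] into union
    is carried along because [count] recurses on [join l c] where these two lemmas have a union. *)
Lemma gadget_topology (X : finType) (O : {set {set X}}) (W : {set X}) g :
  is_topology O -> W \in O ->
  exists (Y : finType) (O' : {set {set Y}}) (phi : opn -> {set Y}),
  [/\ #|Y| = #|X| + size g, is_topology O', phi (0, [::]) = set0,
      (forall l, phi l \in O') /\ {morph phi : l c / join l c >-> l :|: c} &
      forall l, above O' (phi l) =
        (count (above O W) g l).1 * #|O| + (count (above O W) g l).2].
Proof.
move=> topO OW.
elim: g => [|c g [Y [O' [phi [cY topO' phi0 [phiO phiU] cnt]]]]].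
  (* Before any point is added only the level matters; the three levels have [#|O|], [above O W] and
     1 open sets above them. *)
  exists X, O, (fun l => match l.1 with 0 => set0 | 1 => W | _ => setT end).
  case/is_topologyP: (topO) => O0 OT _ _.
  split=> //; first by rewrite addn0.
    split; first by case=> [[|[|e]] s].
    case=> [[|[|e]] s] [[|[|f]] u]; rewrite /= ?set0U ?setU0 ?setUid //.
    - by rewrite setUT.
    - by rewrite setTU.
    - by rewrite !maxnSS.
  case=> [[|[|e]] s] /=; first by rewrite above0 mul1n addn0.
    by rewrite mul0n add0n.
  by rewrite aboveT // mul0n.
pose m := size g.
(* The new point has stage number [m]; a set that lists it must contain its whole smallest
   neighbourhood, hence [phi c]. *)
exists (option Y : finType), (add_point O' (phi c)),
  (fun l => if m \in l.2 then None |: Some @: (phi l :|: phi c)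
            else Some @: phi l).
split.
- by rewrite card_option cY addnS.
- exact: add_point_topology.
- by rewrite /= phi0 imset0.
- split=> [l|l d].
    by case: ifP => _; [apply: add_point_new | apply: add_point_old].
  rewrite /= mem_cat phiU.
  case: (m \in l.2); case: (m \in d.2); rewrite /= -?imsetU //;
    apply/setP => -[x|]; rewrite !inE ?orbT ?mem_imset ?inE //=;
    try exact: Some_inj;
    try by case: (x \in phi l); case: (x \in phi d); case: (x \in phi c).
- move=> l; rewrite count_cons -/m; case: ifP => _.
    by rewrite above_new // -phiU cnt.
  by rewrite above_old // -phiU !cnt /= mulnDl addnACA.
Qed.

(** * Spaces with a tracker, and their extension by gadgets *)

Definition realizes (k n : nat) : Prop :=
  exists (X : finType) (O : {set {set X}}) (W : {set X}),
    [/\ #|X| = n, is_topology O, W \in O, above O W = 3 & #|O| = k].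

(* [(N, xs, (e, s))] stands for [N] isolated points followed by the points [xs];
   its tracker is the open set of level [e] containing all these points but
   those listed in [s]. *)
Definition gadget : Type := nat * seq opn * opn.

Definition stages (d : gadget) : seq opn := rev d.1.2 ++ nseq d.1.1 (0, [::]).

Definition opens (w : nat) (d : gadget) : nat * nat :=
  count w (stages d) (0, [::]).

Definition tracker (d : gadget) : opn :=
  (d.2.1, [seq i <- iota 0 (size (stages d)) | i \notin d.2.2]).

Definition tracked (w : nat) (d : gadget) : nat * nat :=
  count w (stages d) (tracker d).

(** The weight 3 is the number of open sets above the old tracker. The pair [(0, 3)] says that the
    new tracker has three open sets above it whatever [q] is, so gadgets can be iterated. *)
Lemma realizes_gadget d a b q n :
  opens 3 d = (a, b) -> tracked 3 d = (0, 3) ->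
  realizes q n -> realizes (a * q + b) (n + size (stages d)).
Proof.
move=> od td [X [O [W [<- topO OW aW <-]]]].
have [Y [O' [phi [cY topO' phi0 [phiO _] cnt]]]] :=
  gadget_topology (stages d) topO OW.
exists Y, O', (phi (tracker d)).
split=> //; first by rewrite cnt aW -/(tracked 3 d) td.
by rewrite -above0 -phi0 cnt aW -/(opens 3 d) od.
Qed.

Lemma discrete_topology (X : finType) : is_topology [set: {set X}].
Proof. by apply/is_topologyP; split=> [||? ? _ _|? ? _ _]; rewrite in_setT. Qed.

(** A seed is a gadget over the empty space. There the three levels coincide and the empty set is
    the only open set, so [q] and [w] are both 1 and a pair [(a, b)] counts [a + b] open sets. *)
Definition seed_size (d : gadget) : nat := (opens 1 d).1 + (opens 1 d).2.

Lemma realizes_seed d :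
  (tracked 1 d).1 + (tracked 1 d).2 = 3 ->
  realizes (seed_size d) (size (stages d)).
Proof.
move=> td; have c1 : #|[set: {set void}]| = 1.
  by rewrite -powersetT card_powerset cardsT card_void.
have [Y [O' [phi [cY topO' phi0 [phiO _] cnt]]]] :=
  gadget_topology (stages d) (discrete_topology void) (in_setT set0).
rewrite above0 c1 card_void in cY cnt.
exists Y, O', (phi (tracker d)).
split=> //; first by rewrite cnt muln1 -/(tracked 1 d).
by rewrite -above0 -phi0 cnt muln1 -/(opens 1 d).
Qed.

Lemma realizes_card k n : realizes k n -> has_topology_of_card k n.
Proof.
case=> X [O [W [<- topO OW aW cO]]]; apply/andP; split.
  (* An empty space has at most one open set, too few for a tracker. *)
  rewrite lt0n; apply/negP => /eqP cX.
  suff : above O W <= 1 by rewrite aW.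
  rewrite (leq_trans (max_card _)) // -cardsT -powersetT.
  by rewrite card_powerset cardsT cX.
pose f (A : {set 'I_#|X|}) : {set X} := enum_rank @^-1: A.
pose g (A : {set X}) : {set 'I_#|X|} := enum_val @^-1: A.
have fK : cancel f g by move=> A; apply/setP => i; rewrite !inE enum_valK.
have gK : cancel g f by move=> A; apply/setP => x; rewrite !inE enum_rankK.
case/is_topologyP: topO => O0 OT OU OI.
apply/existsP; exists [set A | f A \in O]; apply/andP; split.
  apply/is_topologyP; rewrite !inE /f preimset0 preimsetT; split=> // A B;
    rewrite !inE ?preimsetU ?preimsetI => OA OB; [exact: OU | exact: OI].
rewrite -cO -(card_imset _ (can_inj gK)); apply/eqP/eq_card => A.
rewrite inE; apply/idP/imsetP => [OA|[B OB ->]]; last by rewrite gK.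
by exists (f A); rewrite ?fK.
Qed.

(** This is the floor of $4l/3 + 2$. *)
Definition bound (l : nat) : nat := l + l %/ 3 + 2.

(** * Tables of gadgets and of explicit spaces *)

Definition octal_gadgets : seq gadget := [::
  (3, [::], (1, [::]));
  (3, [:: (2, [:: 0; 1; 2])], (2, [:: 0; 3]));
  (3, [:: (2, [:: 0; 1])], (2, [:: 0; 3]));
  (3, [:: (1, [:: 0; 1; 2])], (2, [:: 0; 3]));
  (3, [:: (2, [:: 0])], (2, [:: 0; 3]));
  (3, [:: (1, [:: 0; 1])], (2, [:: 0; 3]));
  (6, [:: (2, [:: 0; 2; 3; 4; 5]); (2, [:: 1; 2; 3; 4; 5])], (2, [:: 0; 6]));
  (6, [:: (2, [:: 0; 3; 4; 5]); (2, [:: 1; 2; 3; 4; 5])], (2, [:: 0; 6]));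
  (6, [:: (2, [:: 0; 1; 5]); (2, [:: 2; 3; 4; 5])], (2, [:: 0; 6]));
  (6, [:: (2, [:: 0; 4; 5]); (1, [:: 1; 2; 3; 4; 5])], (2, [:: 0; 6]));
  (6, [:: (2, [:: 0; 1]); (2, [:: 2; 3; 4; 5])], (2, [:: 0; 6]));
  (6, [:: (2, [:: 0; 5]); (1, [:: 1; 2; 3; 4; 5])], (2, [:: 0; 6]));
  (6, [:: (2, [:: 0; 1]); (1, [:: 2; 3; 4; 5])], (2, [:: 0; 6]));
  (6, [:: (2, [:: 0]); (1, [:: 1; 2; 3; 4; 5])], (2, [:: 0; 6]));
  (6, [:: (2, [:: 0; 1; 2; 3]); (1, [:: 4; 5])], (2, [:: 0; 6]));
  (6, [:: (1, [:: 0; 1]); (1, [:: 2; 3; 4; 5])], (2, [:: 0; 6]));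
  (9, [:: (2, [:: 0; 2; 3; 7; 8]); (2, [:: 0; 4; 5; 6; 7; 8]); (2, [:: 1; 2;
    3; 4; 5; 6; 7; 8])], (2, [:: 1; 11]));
  (9, [:: (2, [:: 0; 1; 7; 8]); (2, [:: 2; 3; 4; 5; 6; 7; 8])], (2, [:: 0; 9]));
  (9, [:: (2, [:: 0; 1; 7; 8]); (1, [:: 2; 3; 4; 5; 6; 7; 8])], (2, [:: 0; 9]));
  (9, [:: (2, [:: 0; 2; 3; 8]); (2, [:: 0; 4; 5; 6; 7; 8]); (2, [:: 1; 2; 3;
    4; 5; 6; 7; 8])], (2, [:: 1; 11]));
  (9, [:: (2, [:: 0; 2; 3; 4]); (2, [:: 0; 5; 6; 7; 8]); (2, [:: 1; 2; 3; 4;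
    5; 6; 7; 8])], (2, [:: 1; 11]));
  (9, [:: (2, [:: 0; 4; 7; 8]); (2, [:: 0; 5; 6; 7; 8]); (2, [:: 1; 2; 3; 4;
    5; 6; 7; 8])], (2, [:: 1; 11]));
  (9, [:: (2, [:: 0; 1; 5]); (2, [:: 0; 1; 6; 7; 8]); (2, [:: 2; 3; 4; 5; 6;
    7; 8])], (2, [:: 2; 11]));
  (9, [:: (2, [:: 0; 1; 2; 3; 4; 7; 8]); (1, [:: 5; 6; 7; 8])], (2, [:: 0; 9]));
  (9, [:: (2, [:: 0; 4; 5]); (2, [:: 0; 6; 7; 8]); (2, [:: 1; 2; 3; 4; 5; 6;
    7; 8])], (2, [:: 1; 11]));
  (9, [:: (1, [:: 0; 1; 7; 8]); (1, [:: 2; 3; 4; 5; 6; 7; 8])], (2, [:: 0; 9]));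
  (9, [:: (2, [:: 0; 1; 6]); (2, [:: 0; 1; 7; 8]); (2, [:: 2; 3; 4; 5; 6; 7;
    8])], (2, [:: 2; 11]));
  (9, [:: (2, [:: 0; 2; 8]); (2, [:: 1; 2; 7; 8]); (2, [:: 3; 4; 5; 6; 7;
    8])], (2, [:: 0; 9]));
  (9, [:: (2, [:: 0; 7; 8]); (2, [:: 1; 2; 8]); (2, [:: 3; 4; 5; 6; 7; 8])],
    (2, [:: 0; 9]));
  (9, [:: (2, [:: 0; 8]); (2, [:: 0; 5; 6; 7; 8]); (2, [:: 1; 2; 3; 4; 5; 6;
    7; 8])], (2, [:: 1; 11]));
  (9, [:: (2, [:: 0; 2; 8]); (2, [:: 1; 2; 8]); (2, [:: 3; 4; 5; 6; 7; 8])],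
    (2, [:: 0; 9]));
  (9, [:: (2, [:: 0; 3]); (2, [:: 1; 2; 3; 7; 8]); (2, [:: 4; 5; 6; 7; 8])],
    (2, [:: 0; 9]));
  (9, [:: (2, [:: 0; 6]); (2, [:: 1; 2; 7; 8]); (2, [:: 3; 4; 5; 6; 7; 8])],
    (2, [:: 0; 9]));
  (9, [:: (2, [:: 0; 2]); (2, [:: 1; 2; 7; 8]); (2, [:: 3; 4; 5; 6; 7; 8])],
    (2, [:: 0; 9]));
  (9, [:: (2, [:: 0; 7]); (2, [:: 1; 2; 8]); (2, [:: 3; 4; 5; 6; 7; 8])], (2,
    [:: 0; 9]));
  (9, [:: (2, [:: 0; 6]); (2, [:: 0; 7; 8]); (2, [:: 1; 2; 3; 4; 5; 6; 7;
    8])], (2, [:: 1; 11]));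
  (9, [:: (2, [:: 0; 2]); (2, [:: 1; 2; 8]); (2, [:: 3; 4; 5; 6; 7; 8])], (2,
    [:: 0; 9]));
  (9, [:: (2, [:: 0; 8]); (2, [:: 1; 2; 8]); (2, [:: 3; 4; 5; 6; 7; 8])], (2,
    [:: 0; 9]));
  (9, [:: (2, [:: 0; 3]); (2, [:: 1; 2; 3]); (2, [:: 4; 5; 6; 7; 8])], (2, [::
    0; 9]));
  (9, [:: (2, [:: 0; 1]); (2, [:: 2; 3; 4]); (2, [:: 5; 6; 7; 8])], (2, [:: 0;
    9]));
  (9, [:: (2, [:: 0; 5; 8]); (2, [:: 1; 2; 3; 4; 5; 8]); (1, [:: 6; 7; 8])],
    (2, [:: 0; 9]));
  (9, [:: (2, [:: 0]); (2, [:: 0; 5; 6; 7; 8]); (2, [:: 1; 2; 3; 4; 5; 6; 7;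
    8])], (2, [:: 1; 11]));
  (9, [:: (2, [:: 0; 7; 8]); (2, [:: 1; 2; 3; 4; 5; 8]); (1, [:: 6; 7; 8])],
    (2, [:: 0; 9]));
  (9, [:: (2, [:: 0; 8]); (2, [:: 1; 2]); (2, [:: 3; 4; 5; 6; 7; 8])], (2, [::
    0; 9]));
  (9, [:: (2, [:: 0]); (2, [:: 1; 2; 6; 7; 8]); (1, [:: 3; 4; 5; 6; 7; 8])],
    (2, [:: 0; 9]));
  (9, [:: (2, [:: 0; 1]); (2, [:: 2; 3; 4]); (1, [:: 5; 6; 7; 8])], (2, [:: 0;
    9]));
  (9, [:: (2, [:: 0; 5]); (2, [:: 1; 2; 3; 4; 5; 8]); (1, [:: 6; 7; 8])], (2,
    [:: 0; 9]));
  (9, [:: (2, [:: 5; 6]); (2, [:: 0; 1; 2; 3; 4; 5; 7; 8]); (1, [:: 6; 7;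
    8])], (2, [:: 0; 10]));
  (9, [:: (2, [:: 0; 7]); (2, [:: 1; 2; 3; 4; 5; 8]); (1, [:: 6; 7; 8])], (2,
    [:: 0; 9]));
  (9, [:: (2, [:: 0]); (2, [:: 1; 2; 8]); (2, [:: 3; 4; 5; 6; 7; 8])], (2, [::
    0; 9]));
  (9, [:: (2, [:: 0; 8]); (2, [:: 1; 2; 3; 4; 5]); (1, [:: 6; 7; 8])], (2, [::
    0; 9]));
  (9, [:: (2, [:: 0; 1]); (2, [:: 2; 3; 4; 5]); (1, [:: 6; 7; 8])], (2, [:: 0;
    9]));
  (9, [:: (2, [:: 0; 3; 4; 5; 6; 7]); (1, [:: 1; 8]); (1, [:: 2; 3; 4; 5; 6;
    7; 8])], (2, [:: 0; 9]));
  (9, [:: (2, [:: 4; 5; 6; 7; 8]); (2, [:: 0; 1; 2; 3; 4; 5; 6; 8]); (1, [::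
    7; 8])], (2, [:: 0; 10]));
  (9, [:: (2, [:: 0; 1; 4; 5; 6]); (2, [:: 2; 3; 4; 5; 6]); (1, [:: 7; 8])],
    (2, [:: 0; 9]));
  (9, [:: (2, [:: 0; 1; 5; 6; 8]); (2, [:: 2; 3; 4; 5; 6]); (1, [:: 7; 8])],
    (2, [:: 0; 9]));
  (9, [:: (2, [:: 0; 4; 5; 6]); (2, [:: 1; 2; 3; 4; 5; 6]); (1, [:: 7; 8])],
    (2, [:: 0; 9]));
  (9, [:: (2, [:: 0; 5; 6; 8]); (2, [:: 1; 2; 3; 4; 5; 6]); (1, [:: 7; 8])],
    (2, [:: 0; 9]));
  (9, [:: (2, [:: 0]); (2, [:: 1; 2]); (1, [:: 3; 4; 5; 6; 7; 8])], (2, [:: 0;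
    9]));
  (9, [:: (2, [:: 5; 6; 7]); (2, [:: 0; 1; 2; 3; 4; 5; 6; 8]); (1, [:: 7;
    8])], (2, [:: 0; 10]));
  (9, [:: (2, [:: 0; 6; 8]); (2, [:: 1; 2; 3; 4; 5; 6]); (1, [:: 7; 8])], (2,
    [:: 0; 9]));
  (9, [:: (2, [:: 0]); (2, [:: 1; 2; 3; 4; 5; 8]); (1, [:: 6; 7; 8])], (2, [::
    0; 9]));
  (9, [:: (2, [:: 0; 1; 8]); (2, [:: 2; 3; 4; 5; 6]); (1, [:: 7; 8])], (2, [::
    0; 9]));
  (9, [:: (2, [:: 0; 1; 2]); (2, [:: 3; 4; 5; 6]); (1, [:: 7; 8])], (2, [:: 0;
    9]))].

Definition small_gadgets : seq gadget := [::
  (2, [:: (2, [:: 0; 1])], (2, [:: 0; 2]));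
  (2, [:: (1, [:: 0; 1])], (2, [:: 0; 2]));
  (1, [::], (1, [::]));
  (1, [:: (2, [:: 0])], (2, [:: 0; 1]));
  (5, [:: (1, [:: 0]); (1, [:: 0]); (1, [:: 1; 2; 3; 4])], (2, [:: 1; 7]));
  (2, [:: (2, [:: 0]); (1, [:: 1])], (2, [:: 0; 2]));
  (2, [:: (1, [:: 0]); (1, [:: 1])], (2, [:: 0; 2]));
  (2, [:: (1, [:: 0]); (1, [:: 0]); (1, [:: 1])], (2, [:: 1; 4]));
  (5, [:: (2, [:: 3; 4]); (2, [:: 0; 1; 2; 3]); (1, [:: 4])], (2, [:: 0; 6]));
  (5, [:: (2, [:: 0]); (1, [:: 1]); (1, [:: 2; 3; 4])], (2, [:: 0; 5]));
  (5, [:: (2, [:: 0]); (1, [:: 1; 2]); (1, [:: 3; 4])], (2, [:: 0; 5]));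
  (5, [:: (2, [:: 0; 1; 2; 3]); (1, [:: 4]); (1, [:: 2; 3; 4])], (2, [:: 0;
    5]));
  (5, [:: (1, [:: 0]); (1, [:: 0; 3; 4]); (1, [:: 1; 2; 3; 4])], (2, [:: 1;
    7]));
  (5, [:: (2, [:: 0; 1; 2]); (1, [:: 3]); (1, [:: 3]); (1, [:: 4])], (2, [::
    0; 5]));
  (6, [:: (2, [:: 5]); (2, [:: 0; 1; 2; 3; 4]); (1, [:: 5])], (2, [:: 0; 7]));
  (6, [:: (2, [:: 0; 1; 2; 3; 4]); (1, [:: 5]); (1, [:: 5])], (2, [:: 0; 6]));
  (6, [:: (1, [:: 0]); (1, [:: 0]); (1, [:: 1; 2; 3; 4; 5])], (2, [:: 1; 8]));
  (7, [:: (2, [:: 0; 1]); (2, [:: 2; 3; 4; 5; 6])], (2, [:: 0; 7]));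
  (7, [:: (2, [:: 0; 1]); (1, [:: 2; 3; 4; 5; 6])], (2, [:: 0; 7]))].

Definition seeds : seq gadget := [::
  (1, [:: (0, [:: 0])], (0, [:: 0; 1]));
  (1, [:: (0, [:: 0]); (0, [:: 0; 1])], (0, [:: 1; 2]));
  (2, [:: (0, [:: 0; 1])], (0, [:: 0; 2]));
  (1, [:: (0, [:: 0]); (0, [::]); (0, [:: 0; 1; 2])], (0, [:: 2; 3]));
  (5, [:: (0, [:: 0; 2; 4]); (0, [:: 0; 3; 4]); (0, [:: 1; 2; 3; 4])], (0, [::
    1; 7]));
  (5, [:: (0, [:: 0; 4]); (0, [:: 0; 3; 4]); (0, [:: 1; 2; 3; 4])], (0, [:: 1;
    7]));
  (5, [:: (0, [:: 0; 1]); (0, [:: 0; 1; 4]); (0, [:: 2; 3; 4])], (0, [:: 2;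
    7]));
  (5, [:: (0, [:: 0]); (0, [:: 0; 3; 4]); (0, [:: 1; 2; 3; 4])], (0, [:: 1;
    7]));
  (5, [:: (0, [:: 0; 1]); (0, [:: 0; 1]); (0, [:: 2; 3; 4])], (0, [:: 2; 7]));
  (8, [:: (0, [:: 0; 1]); (0, [:: 2; 3; 6; 7]); (0, [:: 4; 5; 6; 7])], (0, [::
    0; 8]));
  (8, [:: (0, [:: 0; 3]); (0, [:: 1; 2; 3; 7]); (0, [:: 4; 5; 6; 7])], (0, [::
    0; 8]));
  (8, [:: (0, [:: 0; 2]); (0, [:: 1; 2; 7]); (0, [:: 3; 4; 5; 6; 7])], (0, [::
    0; 8]));
  (8, [:: (0, [:: 0; 7]); (0, [:: 1; 2]); (0, [:: 3; 4; 5; 6; 7])], (0, [:: 0;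
    8]));
  (8, [:: (0, [:: 0; 1; 2]); (0, [:: 0; 1; 2]); (0, [:: 0; 1; 2; 7]); (0, [::
    3; 4; 5; 6; 7])], (0, [:: 3; 11]));
  (8, [:: (0, [:: 0; 3]); (0, [:: 1; 3]); (0, [:: 0; 1; 4; 5; 6; 7]); (0, [::
    2; 3; 4; 5; 6; 7])], (0, [:: 2; 11]));
  (8, [:: (0, [:: 0]); (0, [:: 0; 2; 3; 7]); (0, [:: 0; 4; 5; 6; 7]); (0, [::
    1; 2; 3; 4; 5; 6; 7])], (0, [:: 1; 11]));
  (8, [:: (0, [:: 0]); (0, [:: 1; 2; 3]); (0, [:: 0; 1; 2; 3; 6; 7]); (0, [::
    4; 5; 6; 7])], (0, [:: 4; 11]));
  (8, [:: (0, [:: 0]); (0, [:: 1; 4; 5; 6]); (0, [:: 0; 1; 7]); (0, [:: 2; 3;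
    4; 5; 6; 7])], (0, [:: 2; 11]));
  (8, [:: (0, [:: 0]); (0, [:: 0; 6; 7]); (0, [:: 1; 5; 6; 7]); (0, [:: 2; 3;
    4; 5; 6; 7])], (0, [:: 1; 10]));
  (8, [:: (0, [:: 0]); (0, [:: 1; 7]); (0, [:: 0; 1; 4; 5; 6; 7]); (0, [:: 2;
    3; 4; 5; 6; 7])], (0, [:: 2; 11]))].

(** * Finite verification of the tables *)

Definition summary (d : gadget) : nat * nat * nat :=
  (d.1.1, (opens 3 d).2, size (stages d)).

(** Small gadgets may cost more than four points per three digits, so the cost is tested at the
    given [k], where the rounding in [bound] or a large [r] can pay for it. The equation makes the
    division exact, and [2 < q] leaves room for a tracker. *)
Definition usable (k : nat) (s : nat * nat * nat) : bool :=
  let: (N, r, n) := s in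
  let q := (k - r) %/ 2 ^ N in
  [&& 2 < q, k == 2 ^ N * q + r &
      bound (trunc_log 2 q) + n <= bound (trunc_log 2 k)].

(** Each isolated point doubles the coefficient of $q$; the other points lie above the tracker or
    the whole old space and only change the constant term. *)
Lemma gadgetsP :
  {in octal_gadgets ++ small_gadgets, forall d,
    opens 3 d = (2 ^ d.1.1, (opens 3 d).2) /\ tracked 3 d = (0, 3)}.
Proof.
suff /allP H :
    all (fun d => ((opens 3 d).1 == 2 ^ d.1.1) && (tracked 3 d == (0, 3)))
      (octal_gadgets ++ small_gadgets).
  move=> d /H /andP[/eqP od /eqP td]; split=> //.
  by rewrite -od -surjective_pairing.
by vm_compute.
Qed.

Lemma octal_gadgets_size :
  {in octal_gadgets, forall d, 3 %| d.1.1 /\ 3 * size (stages d) <= 4 * d.1.1}.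
Proof.
suff /allP H :
    all (fun d => (3 %| d.1.1) && (3 * size (stages d) <= 4 * d.1.1))
      octal_gadgets by move=> d /H /andP[].
by vm_compute.
Qed.

(** The gadgets with three isolated points give the residues 0, 1, 2, 3, 4 and 6 modulo 8; the
    classes of 5 and 7 are left to the moduli $2^6$ and $2^9$. All moduli divide $2^9$, so 512
    residues are checked. *)
Lemma octal_gadgets_cover k :
  exists2 d, d \in octal_gadgets & k %% 2 ^ d.1.1 = (opens 3 d).2.
Proof.
have /allP/(_ (k %% 2 ^ 9)) : all (fun r => has (fun s : nat * nat * nat =>
    (s.1.1 <= 9) && (r %% 2 ^ s.1.1 == s.1.2)) (map summary octal_gadgets))
  (iota 0 (2 ^ 9)) by vm_compute.
rewrite mem_iota ltn_mod expn_gt0.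
move=> /(_ isT) /hasP[_ /mapP[d dG ->]] /andP[le9].
by rewrite modn_dvdm ?dvdn_exp2l // => /eqP kd; exists d.
Qed.

Lemma seedsP :
  {in seeds, forall d, (tracked 1 d).1 + (tracked 1 d).2 = 3 /\
    size (stages d) <= bound (trunc_log 2 (seed_size d))}.
Proof.
suff /allP H : all (fun d => ((tracked 1 d).1 + (tracked 1 d).2 == 3) &&
    (size (stages d) <= bound (trunc_log 2 (seed_size d)))) seeds.
  by move=> d /H /andP[/eqP].
by vm_compute.
Qed.

(** A quotient below 3 cannot carry a tracker, so the octal step fails there. Each octal gadget
    leaves only three such [k], and all of them are checked. *)
Lemma small_cover d q : d \in octal_gadgets -> q < 3 ->
  let k := q * 2 ^ d.1.1 + (opens 3 d).2 in
  2 < k ->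
  k \in map seed_size seeds \/ has (usable k) (map summary small_gadgets).
Proof.
move=> dG q3 k k3; apply/orP.
have /allP/(_ _ (map_f summary dG))/allP/(_ q) :
  all (fun s : nat * nat * nat =>
        all (fun q => let k := q * 2 ^ s.1.1 + s.1.2 in
          (2 < k) ==> (k \in map seed_size seeds)
                      || has (usable k) (map summary small_gadgets)) (iota 0 3))
    (map summary octal_gadgets) by vm_compute.
by rewrite mem_iota => /(_ q3) /implyP; apply.
Qed.

(** * Induction on the number of open sets *)

Lemma trunc_log_shift N q r :
  0 < q -> N + trunc_log 2 q <= trunc_log 2 (q * 2 ^ N + r).
Proof.
move=> q0; apply: trunc_log_max => //; rewrite expnD mulnC.
by rewrite (leq_trans _ (leq_addr _ _)) // leq_mul2r trunc_logP ?orbT.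
Qed.

(** Strong induction through the quotient of [k] by a power of two. It starts at 3 because a tracker
    needs three open sets above it. *)
Lemma realizes_bound k :
  2 < k -> exists2 n, realizes k n & n <= bound (trunc_log 2 k).
Proof.
elim/ltn_ind: k => k IH k3.
have [d dG kd] := octal_gadgets_cover k.
have defk := divn_eq k (2 ^ d.1.1); rewrite kd in defk.
have N0 : 0 < d.1.1.
  suff /allP/(_ _ dG) : all (fun d : gadget => 0 < d.1.1) octal_gadgets by [].
  by [].
have [q3|q3] := leqP 3 (k %/ 2 ^ d.1.1).
  have [|n Rn len] := IH _ _ q3.
    by rewrite ltn_Pdiv // ?(ltn_trans _ k3) // -[1]/(2 ^ 0) ltn_exp2l.
  have dA : d \in octal_gadgets ++ small_gadgets by rewrite mem_cat dG.
  have [od td] := gadgetsP dA.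
  exists (n + size (stages d)).
    by rewrite {1}defk mulnC; apply: realizes_gadget Rn.
  (* As 3 divides the number $N$ of new binary digits, [bound] grows by exactly $4N/3$ from $l$ to
     $l + N$, without rounding loss, and this covers the points of the gadget. *)
  have [/dvdnP[t Nt] szd] := octal_gadgets_size dG.
  have := trunc_log_shift d.1.1 (opens 3 d).2 (ltn_trans (isT : 0 < 2) q3).
  rewrite -defk; move: len szd Nt; rewrite /bound.
  move: (trunc_log 2 k) (trunc_log 2 _) (size _) d.1.1 => L l z N; lia.
have := small_cover dG q3; rewrite -defk => /(_ k3) [/mapP[s sS ->]|].
  have [ts ls] := seedsP sS.
  by exists (size (stages s)) => //; apply: realizes_seed.
case/hasP=> _ /mapP[s sG ->] /and3P[q3' /eqP ks lens].
have [|n Rn len] := IH _ _ q3'.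
  rewrite (leq_ltn_trans (leq_div2r _ (leq_subr _ _))) //.
  rewrite ltn_Pdiv // ?(ltn_trans _ k3) // -[1]/(2 ^ 0) ltn_exp2l //.
  suff /allP/(_ _ sG) : all (fun d : gadget => 0 < d.1.1) small_gadgets by [].
  by [].
have sA : s \in octal_gadgets ++ small_gadgets by rewrite mem_cat sG orbT.
have [od td] := gadgetsP sA.
exists (n + size (stages s)); last by apply: leq_trans lens; rewrite leq_add2r.
by rewrite {1}ks; apply: realizes_gadget Rn.
Qed.

(** * Passage to [m] and to rational numbers *)

Lemma m_le k hk n : has_topology_of_card k n -> m k hk <= n.
Proof. by rewrite /m; case: ex_minnP => p _; apply. Qed.

Lemma m_bound k hk : m k hk <= bound (trunc_log 2 k).
Proof.
have := hk; rewrite leq_eqVlt => /predU1P[k2|/realizes_bound[n Rn]]; last first.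
  by apply: leq_trans; apply/m_le/realizes_card.
(* For [k] equal to 2 there is no tracker; the one-point space serves directly. *)
apply: (@leq_trans 1); last by rewrite /bound addn2.
apply: m_le; apply/andP; split=> //; apply/existsP; exists setT.
by rewrite discrete_topology -k2 -powersetT card_powerset cardsT card_ord.
Qed.

Local Open Scope ring_scope.

(* [trunc_log 2 k] is the floor of the base-2 logarithm of [k], as [0 < k]. *)
Theorem theorem3p11 (k : nat) (hk : (2 <= k)%N) :
  (m k hk)%:R <= 4 / 3 * (trunc_log 2 k)%:R + 2 :> rat.
Proof.
(* Multiplying by 3 removes both the floor in [bound] and the fraction in the goal. *)
have H : (3 * m k hk <= 4 * trunc_log 2 k + 6)%N.
  by have := m_bound hk; rewrite /bound; lia.
have : (3 * m k hk)%:R <= (4 * trunc_log 2 k + 6)%:R :> rat.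
  by rewrite Num.Theory.ler_nat.
by rewrite GRing.natrD !GRing.natrM; lra.
Qed.
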